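(* Let $X$ be a Banach space. Then the mapping $p \mapsto n_L^p(X)$ from $(\mathcal{E}(X),\mu)$ to $\mathbb{R}$ is continuous. Hence the set $\mathcal{N}_L(X) = \{ n_L^p(X) : p \in \mathcal{E}(X)\}$ is an interval.
   Context: $X$ is a real or complex Banach space with dual $X^*$. $\mathcal{E}(X)$ is the set of all equivalent norms on $X$, with the metric $\mu(p,q) = \log\left(\min\{k \ge 1 : p \le kq,\ q \le kp\}\right)$. For $p\in\mathcal{E}(X)$, the dual norm on $X^*$ is also denoted by $p$. $\mathrm{Lip}_0(X,X)$ is the space of Lipschitz maps $T:X\to X$ with $T(0)=0$; for $p \in \mathcal{E}(X)$ the Lipschitz norm of $T$ with respect to $p$ is $\|T\|_p=\sup\{p(Tx-Ty)/p(x-y): x\neq y\}$. Put $\Pi_p = \{(x,y,x^* )\in X\times X\times X^* : x\ne y,\ x^*(x-y)=p(x^* )p(x-y)=p(x-y)^2\}$, and $\nu_L^p(T)=\sup\left\{ \frac{|x^*(Tx-Ty)|}{p(x-y)^2} : (x,y,x^* )\in\Pi_p\right\}$. The Lipschitz numerical index with respect to $p$ is $n_L^p(X)=\inf\{\nu_L^p(T): T\in \mathrm{Lip}_0(X,X),\ \|T\|_p=1\}$. *)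

(* Defs.v *)
From HB Require Import structures.
From mathcomp Require Import all_boot all_order all_algebra.
From mathcomp Require Import complex.
From mathcomp Require Import all_classical all_reals all_analysis.
Set Implicit Arguments.
Unset Strict Implicit.
Unset Printing Implicit Defensive.
Import Order.TTheory GRing.Theory Num.Theory.
Import numFieldNormedType.Exports.
Local Open Scope classical_set_scope.
Local Open Scope ring_scope.

Variant scalar_kind := RealScalars | ComplexScalars.

Definition scalars (R : realType) (s : scalar_kind) : numFieldType :=
  match s with RealScalars => R | ComplexScalars => R[i] end.

Definition of_real (R : realType) (s : scalar_kind) : R -> scalars R s :=
  match s with RealScalars => fun r => r | ComplexScalars => real_complex R end.

Definition re_part (R : realType) (s : scalar_kind) : scalars R s -> R :=
  match s with RealScalars => fun r => r | ComplexScalars => @complex.Re R end.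

(* Over K = scalars R s the library norm `|_| is K-valued (with real values);
   rnorm is its R-valued version, both on K and on normed K-modules. *)
Definition rnorm (R : realType) (s : scalar_kind)
  (V : normedZmodType (scalars R s)) (v : V) : R := re_part `|v|.

Definition is_norm (R : realType) (s : scalar_kind)
    (X : normedModType (scalars R s)) (p : X -> R) : Prop :=
  [/\ forall x, p x = 0 -> x = 0,
      forall x y, p (x + y) <= p x + p y &
      forall (a : scalars R s) x, p (a *: x) = rnorm a * p x].

Definition equivalent_to_norm (R : realType) (s : scalar_kind)
    (X : normedModType (scalars R s)) (p : X -> R) : Prop :=
  exists c C : R, [/\ 0 < c, 0 < C &
    forall x, c * rnorm x <= p x /\ p x <= C * rnorm x].

Record eqnorm (R : realType) (s : scalar_kind)
    (X : normedModType (scalars R s)) := EqNorm {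
  eqnorm_fun :> X -> R ;
  eqnorm_is_norm : is_norm eqnorm_fun ;
  eqnorm_equiv : equivalent_to_norm eqnorm_fun }.

Definition comparison_set (R : realType) (s : scalar_kind)
    (X : normedModType (scalars R s)) (p q : eqnorm X) : set R :=
  [set k | 1 <= k /\ forall x, p x <= k * q x /\ q x <= k * p x].

(* The infimum is a minimum: see comparison_set_min. *)
Definition eqnorm_dist (R : realType) (s : scalar_kind)
    (X : normedModType (scalars R s)) (p q : eqnorm X) : R :=
  ln (inf (comparison_set p q)).

Lemma rnorm_ge0 (R : realType) (s : scalar_kind)
  (V : normedZmodType (scalars R s)) (v : V) : 0 <= rnorm v.
Proof.
rewrite /rnorm; have := normr_ge0 v.
by case: s V v => V v //=; rewrite lecE /= => /andP[].
Qed.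

Lemma eqnorm_ge0 (R : realType) (s : scalar_kind)
  (X : normedModType (scalars R s)) (p : eqnorm X) x : 0 <= p x.
Proof.
have [c [C [c0 _ /(_ x)[h _]]]] := eqnorm_equiv p.
by apply: le_trans h; rewrite mulr_ge0 ?rnorm_ge0// ltW.
Qed.

Lemma eqnorm0 (R : realType) (s : scalar_kind)
  (X : normedModType (scalars R s)) (p : eqnorm X) : p 0 = 0.
Proof.
have [_ _ /(_ 0 0)] := eqnorm_is_norm p.
rewrite scale0r => ->; rewrite /rnorm normr0.
by case: s X p => X p /=; rewrite mul0r.
Qed.

Lemma comparison_set_nonempty (R : realType) (s : scalar_kind)
  (X : normedModType (scalars R s)) (p q : eqnorm X) :
  comparison_set p q !=set0.
Proof.
have [c [C [c0 C0 h]]] := eqnorm_equiv p.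
have [d [D [d0 D0 g]]] := eqnorm_equiv q.
exists (1 + C / d + D / c); split.
  by rewrite -addrA lerDl addr_ge0// divr_ge0// ltW.
have step a A (n u v : R) : 0 < a -> 0 < A -> a * n <= u -> v <= A * n ->
    v <= A / a * u.
  move=> a0 A0 au vA; apply: (le_trans vA).
  by rewrite -mulrA ler_pM2l// mulrC ler_pdivlMr// mulrC.
have le1 (u a b : R) : 0 <= u -> 0 <= b -> a * u <= (1 + a + b) * u.
  by move=> u0 b0; rewrite ler_wpM2r// addrAC lerDr addr_ge0.
move=> x; have [h1 h2] := h x; have [g1 g2] := g x; split.
  apply: (le_trans (step _ _ _ _ _ d0 C0 g1 h2)).
  by rewrite le1 ?eqnorm_ge0// divr_ge0// ltW.
apply: (le_trans (step _ _ _ _ _ c0 D0 h1 g2)).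
by rewrite addrAC le1 ?eqnorm_ge0// divr_ge0// ltW.
Qed.

Lemma comparison_set_min (R : realType) (s : scalar_kind)
  (X : normedModType (scalars R s)) (p q : eqnorm X) :
  comparison_set p q (inf (comparison_set p q)).
Proof.
have ne := comparison_set_nonempty p q.
have key (f g : eqnorm X) x :
    (forall k, comparison_set p q k -> f x <= k * g x) ->
    f x <= inf (comparison_set p q) * g x.
  move=> H; have [g0|gn0] := eqVneq (g x) 0.
    have [/(_ x g0) -> _ _] := eqnorm_is_norm g.
    by rewrite !eqnorm0 mulr0.
  have gp : 0 < g x by rewrite lt_neqAle eq_sym gn0 eqnorm_ge0.
  rewrite -ler_pdivrMr//; apply: lb_le_inf => // k Sk.
  by rewrite ler_pdivrMr// H.
split; first by apply: lb_le_inf => // k [].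
by move=> x; split; apply: key => k [_ /(_ x)[]].
Qed.

Lemma inf_comparison_set_le (R : realType) (s : scalar_kind)
  (X : normedModType (scalars R s)) (p q : eqnorm X) k :
  comparison_set p q k -> inf (comparison_set p q) <= k.
Proof. by move=> Sk; apply: ge_inf => //; exists 1 => l []. Qed.

Lemma eqnorm_eq (R : realType) (s : scalar_kind)
  (X : normedModType (scalars R s)) (p q : eqnorm X) : p =1 q -> p = q.
Proof.
case: p q => [p p1 p2] [q q1 q2] /= /funext pq; subst q.
by rewrite (Prop_irrelevance p1 q1) (Prop_irrelevance p2 q2).
Qed.

Lemma eqnorm_distxx (R : realType) (s : scalar_kind)
  (X : normedModType (scalars R s)) (p : eqnorm X) : eqnorm_dist p p = 0.
Proof.
rewrite /eqnorm_dist; have [le1 _] := comparison_set_min p p.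
have -> : inf (comparison_set p p) = 1; last by rewrite ln1.
apply/eqP; rewrite eq_le le1 andbT; apply: inf_comparison_set_le.
by split => // x; rewrite mul1r.
Qed.

Lemma eqnorm_dist_positivity (R : realType) (s : scalar_kind)
  (X : normedModType (scalars R s)) (p q : eqnorm X) :
  eqnorm_dist p q = 0 -> p = q.
Proof.
rewrite /eqnorm_dist; have [le1 h] := comparison_set_min p q.
move=> /eqP; rewrite ln_eq0 ?(lt_le_trans ltr01)// => /eqP e.
apply: eqnorm_eq => x; have := h x; rewrite e !mul1r => -[a b].
by apply/eqP; rewrite eq_le a.
Qed.

Lemma eqnorm_dist_sym (R : realType) (s : scalar_kind)
  (X : normedModType (scalars R s)) (p q : eqnorm X) :
  eqnorm_dist p q = eqnorm_dist q p.
Proof.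
congr (ln (inf _)); apply/seteqP; split => k [k1 h]; split => // x;
  by have [] := h x.
Qed.

Lemma eqnorm_dist_triangle (R : realType) (s : scalar_kind)
  (X : normedModType (scalars R s)) (q p r : eqnorm X) :
  eqnorm_dist p r <= eqnorm_dist p q + eqnorm_dist q r.
Proof.
rewrite /eqnorm_dist.
have [a1 ha] := comparison_set_min p q.
have [b1 hb] := comparison_set_min q r.
have [c1 _] := comparison_set_min p r.
set a := inf _ in a1 ha *; set b := inf (comparison_set q r) in b1 hb *.
have a0 : 0 < a by rewrite (lt_le_trans ltr01).
have b0 : 0 < b by rewrite (lt_le_trans ltr01).
rewrite -lnM ?posrE// ler_ln ?posrE ?mulr_gt0//; last first.
  by rewrite (lt_le_trans ltr01).
apply: inf_comparison_set_le; split; first by rewrite mulr_ege1.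
move=> x; have [pa qa] := ha x; have [qb rb] := hb x; split.
  by apply: (le_trans pa); rewrite -mulrA ler_pM2l.
by apply: (le_trans rb); rewrite (mulrC a) -mulrA ler_pM2l.
Qed.

HB.instance Definition _ (R : realType) (s : scalar_kind)
  (X : normedModType (scalars R s)) := gen_eqMixin (eqnorm X).
HB.instance Definition _ (R : realType) (s : scalar_kind)
  (X : normedModType (scalars R s)) := gen_choiceMixin (eqnorm X).
HB.instance Definition _ (R : realType) (s : scalar_kind)
  (X : normedModType (scalars R s)) :=
  @isMetric.Build R (eqnorm X) (@eqnorm_dist R s X)
    (@eqnorm_distxx R s X) (@eqnorm_dist_positivity R s X)
    (@eqnorm_dist_sym R s X) (@eqnorm_dist_triangle R s X).

Definition dual_norm (R : realType) (s : scalar_kind)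
    (X : normedModType (scalars R s)) (p : eqnorm X)
    (f : {linear X -> (scalars R s)^o}) : R :=
  sup [set r | exists2 x, p x <= 1 & r = rnorm (f x)].

Definition Lip0 (R : realType) (s : scalar_kind)
    (X : normedModType (scalars R s)) : set (X -> X) :=
  [set T | T 0 = 0 /\ exists k : scalars R s, k.-lipschitz T].

Definition lip_norm (R : realType) (s : scalar_kind)
    (X : normedModType (scalars R s)) (p : eqnorm X) (T : X -> X) : R :=
  sup [set r | exists x y, x != y /\ r = p (T x - T y) / p (x - y)].

Definition lip_Pi (R : realType) (s : scalar_kind)
    (X : normedModType (scalars R s)) (p : eqnorm X) :
    set (X * X * {linear X -> (scalars R s)^o}) :=
  [set t : X * X * {linear X -> (scalars R s)^o} | let: (x, y, f) := t in
    [/\ continuous f, x != y,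
        f (x - y) = of_real s (dual_norm p f * p (x - y)) &
        dual_norm p f * p (x - y) = p (x - y) ^+ 2]].

Definition lip_radius (R : realType) (s : scalar_kind)
    (X : normedModType (scalars R s)) (p : eqnorm X) (T : X -> X) : R :=
  sup [set r | exists x y f, lip_Pi p (x, y, f) /\
                 r = rnorm (f (T x - T y)) / p (x - y) ^+ 2].

(* For X = 0 no T has lip_norm 1; the value is then inf set0 = 0. *)
Definition lip_index (R : realType) (s : scalar_kind)
    (X : normedModType (scalars R s)) (p : eqnorm X) : R :=
  inf [set r | exists T, [/\ Lip0 T, lip_norm p T = 1 & r = lip_radius p T]].

(* Main.v *)
Require Import Defs.
From HB Require Import structures.
From mathcomp Require Import all_boot all_order all_algebra.
From mathcomp Require Import all_classical all_reals all_analysis.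
From mathcomp Require Import complex ring lra.
Set Implicit Arguments.
Unset Strict Implicit.
Unset Printing Implicit Defensive.
Import Order.TTheory GRing.Theory Num.Theory.
Import numFieldNormedType.Exports.
Local Open Scope classical_set_scope.
Local Open Scope ring_scope.

(* Let p, q be norms with p <= k q and q <= k p, let T be 1-Lipschitz for p, and
   put d = x - y, e = T x - T y.
   A Hahn-Banach functional supporting p at d + a e (a a small scalar) is paired
   with the points x + a e and y, whose images under T differ from e by at most
   |a| p(d); this gives p (d + a e) <= p(d) (1 + |a| nu_p(T) + 2 |a|^2), without
   the Bishop-Phelps-Bollobas theorem or completeness. Conversely, if f supports
   q at d, then for a suitable a of modulus t,
   q(d)^2 + t |f e| = |f (d + a e)| <= q(d) q (d + a e).
   Chaining both through q <= k p <= k^2 q bounds nu_q(T) by nu_p(T) + 6 t as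
   soon as k^2 <= 1 + t^2, uniformly in T, whence the continuity of the index.
   The range is an interval because t |-> |1 - t| p + |t| q is a continuous path
   of norms from p to q. *)

(** * Hahn-Banach support functionals on a real vector space *)

Definition sublinear (R : realType) (V : lmodType R) (f : V -> R) : Prop :=
  (forall x y, f (x + y) <= f x + f y) /\
  (forall t x, 0 <= t -> f (t *: x) = t * f x).

Lemma sublinear0 (R : realType) (V : lmodType R) (f : V -> R) :
  sublinear f -> f 0 = 0.
Proof. by move=> [_ /(_ 0 0 (lexx 0))]; rewrite scale0r mul0r. Qed.

Lemma sublinear_oppr_ge (R : realType) (V : lmodType R) (f : V -> R) x :
  sublinear f -> - f (- x) <= f x.
Proof.
move=> fS; have [/(_ x (- x)) + _] := fS.
by rewrite subrr sublinear0// addrC -lerBlDl sub0r.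
Qed.

(** The minorant [l] makes every pointwise infimum genuine. Subadditivity and homogeneity are asked
    of the family only up to passing to another member [h], so that the result serves both the
    family of shifts in [sublinear_shift] and chains in Zorn's lemma. *)
Lemma inf_sublinear (R : realType) (V : lmodType R) (F : set (V -> R))
    (l : V -> R) :
  F !=set0 -> (forall f, F f -> forall z, l z <= f z) ->
  (forall f, F f -> f 0 = 0) ->
  (forall f g z w, F f -> F g -> exists2 h, F h & h (z + w) <= f z + g w) ->
  (forall f c z, F f -> 0 < c -> exists2 h, F h & h (c *: z) <= c * f z) ->
  sublinear (fun z => inf [set f z | f in F]).
Proof.
move=> [f0 Ff0] Fl F0 FD FZ; pose m z := inf [set f z | f in F].
have m_le f z : F f -> m z <= f z.
  move=> Ff; apply: ge_inf; last by exists f.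
  by exists (l z) => _ [g Fg <-]; exact: Fl.
have m_ge z a : (forall f, F f -> a <= f z) -> a <= m z.
  move=> h; apply: lb_le_inf; first by exists (f0 z), f0.
  by move=> _ [f Ff <-]; exact: h.
have m0 : m 0 = 0.
  by apply/eqP; rewrite eq_le -{1}(F0 _ Ff0) m_le// m_ge// => f /F0 ->.
have mZ c z : 0 < c -> m (c *: z) <= c * m z.
  move=> c0; rewrite mulrC -ler_pdivrMr//; apply: m_ge => f Ff.
  rewrite ler_pdivrMr// mulrC.
  by have [h Fh] := FZ _ c z Ff c0; apply: le_trans; exact: m_le.
split=> [x y|t x]; rewrite -!/(m _).
  rewrite -lerBlDl; apply: (m_ge) => g Fg; rewrite lerBlDl -lerBlDr.
  apply: (m_ge) => f Ff; rewrite lerBlDr.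
  by have [h Fh] := FD _ _ x y Ff Fg; apply: le_trans; exact: m_le.
rewrite le_eqVlt => /predU1P[<-|t0]; first by rewrite scale0r mul0r m0.
(* The reverse inequality is [mZ] for the factor [t^-1] at the point [t *: x]. *)
apply/eqP; rewrite eq_le mZ//= mulrC -ler_pdivlMr// mulrC.
have := mZ t^-1 (t *: x); rewrite invr_gt0 scalerA mulVf ?gt_eqF// scale1r.
exact.
Qed.

(** Take g z to be the infimum over t >= 0 of f (z + t x) - t f x. All these terms are at least - f
    (- z); t = 0 gives g <= f, and t = 1 gives the value at - x. Adding parameters yields
    subadditivity, scaling them homogeneity. *)
Lemma sublinear_shift (R : realType) (V : lmodType R) (f : V -> R) x :
  sublinear f -> exists g, [/\ sublinear g, forall z, g z <= f z &
    g (- x) <= - f x].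
Proof.
move=> fS; have [fD fZ] := fS.
pose s t z := f (z + t *: x) - t * f x.
pose F := [set s t | t in [set t | 0 <= t]].
have s_ge t z : 0 <= t -> - f (- z) <= s t z.
  move=> t0; rewrite /s -fZ// lerBrDl lerBlDr.
  by have := fD (z + t *: x) (- z); rewrite addrAC subrr add0r.
have le_s t z : 0 <= t -> inf [set h z | h in F] <= s t z.
  move=> t0; apply: ge_inf; last by exists (s t) => //; exists t.
  by exists (- f (- z)) => _ [_ [r r0 <-] <-]; exact: s_ge.
exists (fun z => inf [set h z | h in F]); split.
- apply: (@inf_sublinear _ _ _ (fun z => - f (- z))).
  + by exists (s 0), 0 => /=.
  + by move=> _ [t t0 <-] z; exact: s_ge.
  + by move=> _ [t t0 <-]; rewrite /s add0r fZ// subrr.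
  + move=> _ _ z w [t t0 <-] [r r0 <-]; exists (s (t + r)).
      by exists (t + r) => //=; exact: addr_ge0.
    rewrite /s mulrDl scalerDl addrACA opprD [leRHS]addrACA.
    by rewrite lerD2r.
  + move=> _ c z [t t0 <-] c0; exists (s (c * t)).
      by exists (c * t) => //=; rewrite mulr_ge0// ltW.
    by rewrite /s -scalerA -scalerDr (fZ c) ?(ltW c0)// mulrBr mulrA.
- move=> z; apply: le_trans (le_s 0 z _) _; rewrite // /s scale0r addr0.
  by rewrite mul0r subr0.
- apply: le_trans (le_s 1 _ ler01) _.
  by rewrite /s scale1r addNr sublinear0// mul1r sub0r.
Qed.

(* A minimal sublinear functional f is linear: by minimality it lies below its
   shift along x, which gives f (- x) = - f x. *)
Lemma sublinear_ge_linear (R : realType) (V : lmodType R) (p : V -> R) :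
  sublinear p -> exists f : {linear V -> R^o}, forall x, f x <= p x.
Proof.
move=> pS.
pose T := {f : V -> R | sublinear f /\ forall x, f x <= p x}.
(* The order is reversed, so that a maximal element is a minimal functional. *)
pose le (f g : T) := `[< forall x, sval g x <= sval f x >].
pose P : T := exist _ p (conj pS (fun=> lexx _)).
have [| | |[f [fS fp]] fmin] := @ZL_preorder T P le.
- by move=> f; apply/asboolP.
- move=> f g h /asboolP fg /asboolP gh; apply/asboolP => x.
  exact: le_trans (gh x) (fg x).
(* The empty chain is bounded by [p], any other by its pointwise infimum: of two members of a chain,
   the smaller one serves as [h] in [inf_sublinear]. *)
- move=> A Atot; have [[f0 Af0]|A0] := pselect (A !=set0); last first.
    by exists P => f Af; case: A0; exists f.
  pose F := [set sval f | f in A].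
  have Fge f : F f -> forall z, - p (- z) <= f z.
    move=> [[g [gS gp]] _ <-] z /=.
    by apply: le_trans (sublinear_oppr_ge z gS); rewrite lerN2.
  have mS : sublinear (fun z => inf [set f z | f in F]).
    apply: (@inf_sublinear _ _ F (fun z => - p (- z))) => //.
    + by exists (sval f0), f0.
    + by move=> _ [[g [gS gp]] _ <-]; exact: sublinear0.
    + move=> _ _ z w [f Af <-] [g Ag <-].
      have [/asboolP fg|/asboolP fg] := Atot _ _ Af Ag.
        exists (sval g); first by exists g.
        have [[/(_ z w) + _] _] := svalP g => /le_trans; apply.
        by rewrite lerD2r.
      exists (sval f); first by exists f.
      have [[/(_ z w) + _] _] := svalP f => /le_trans; apply.
      by rewrite lerD2l.
    + move=> _ c z [f Af <-] c0; exists (sval f); first by exists f.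
      have [[_ fZ] _] := svalP f.
      by rewrite (fZ _ _ (ltW c0)).
  have mle f z : A f -> inf [set f z | f in F] <= sval f z.
    move=> Af; apply: ge_inf; last by exists (sval f) => //; exists f.
    by exists (- p (- z)) => _ [g Fg <-]; exact: Fge.
  have mp z : inf [set f z | f in F] <= p z.
    by apply: le_trans (mle f0 z Af0) _; have [_] := svalP f0.
  exists (exist _ (fun z => inf [set f z | f in F]) (conj mS mp)) => f Af.
  by apply/asboolP => z; exact: mle.
have [fD fZ] := fS.
have fN x : f (- x) = - f x.
  apply/eqP; rewrite eq_le lerNl sublinear_oppr_ge// andbT.
  have [g [gS gf gx]] := sublinear_shift x fS.
  have gp z : g z <= p z by exact: le_trans (gf z) (fp z).
  have /asboolP/(_ (- x))/= := fmin (exist _ g (conj gS gp)) (asboolT gf).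
  by move/le_trans; exact.
have fadd x y : f (x + y) = f x + f y.
  apply/eqP; rewrite eq_le fD/= -lerBrDr -fN.
  by apply: le_trans (fD _ _); rewrite addrK.
have flin : linear (f : V -> R^o).
  move=> a x y; rewrite fadd; congr (_ + _).
  have [a0|/ltW a0] := leP 0 a; first by rewrite fZ.
  have -> : a *: x = - ((- a) *: x) by rewrite scaleNr opprK.
  by rewrite fN fZ ?oppr_ge0// mulNr opprK.
pose L := GRing.isLinear.Build R V R^o *:%R (f : V -> R^o) flin.
pose fL : {linear V -> R^o} := HB.pack (f : V -> R^o) L.
by exists fL.
Qed.

(** A linear f below the shift q of p along x satisfies - f x = f (- x) <= q (- x) <= - p x, which
    forces equality at x. *)
Lemma hahn_banach_support (R : realType) (V : lmodType R) (p : V -> R) (x : V) :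
  sublinear p ->
  exists f : {linear V -> R^o}, (forall z, f z <= p z) /\ f x = p x.
Proof.
move=> pS; have [q [qS qp qx]] := sublinear_shift x pS.
have [f fq] := sublinear_ge_linear qS; exists f.
have fp z : f z <= p z by exact: le_trans (fq z) (qp z).
split => //; apply/eqP; rewrite eq_le fp/=.
by have := le_trans (fq _) qx; rewrite linearN lerN2.
Qed.

(** * Uniform treatment of real and complex scalars *)

Lemma of_real_is_zmod_morphism (R : realType) (s : scalar_kind) :
  zmod_morphism (@of_real R s).
Proof. by case: s => //=; exact: raddfB. Qed.

Lemma of_real_is_monoid_morphism (R : realType) (s : scalar_kind) :
  monoid_morphism (@of_real R s).
Proof. by case: s => //=; split; [exact: rmorph1|exact: rmorphM]. Qed.

HB.instance Definition _ (R : realType) (s : scalar_kind) :=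
  GRing.isZmodMorphism.Build R (scalars R s) (@of_real R s)
    (@of_real_is_zmod_morphism R s).
HB.instance Definition _ (R : realType) (s : scalar_kind) :=
  GRing.isMonoidMorphism.Build R (scalars R s) (@of_real R s)
    (@of_real_is_monoid_morphism R s).

Lemma of_realK (R : realType) (s : scalar_kind) :
  cancel (@of_real R s) (@re_part R s).
Proof. by case: s. Qed.

Lemma of_real_rnorm (R : realType) (s : scalar_kind)
  (V : normedZmodType (scalars R s)) (v : V) : of_real s (rnorm v) = `|v|.
Proof.
rewrite /rnorm; have := normr_ge0 v.
by case: s V v => V v //= /ger0_real; exact: RRe_real.
Qed.

Lemma rnormM (R : realType) (s : scalar_kind) (a b : scalars R s) :
  rnorm (a * b) = rnorm a * rnorm b.
Proof.
by apply: (can_inj (@of_realK R s)); rewrite rmorphM/= !of_real_rnorm normrM.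
Qed.

Lemma ler_of_real (R : realType) (s : scalar_kind) :
  {mono @of_real R s : x y / x <= y}.
Proof. by case: s => //= x y; rewrite lecR. Qed.

Lemma rnorm_of_real (R : realType) (s : scalar_kind) (r : R) :
  rnorm (of_real s r) = `|r|.
Proof.
apply: (can_inj (@of_realK R s)); rewrite of_real_rnorm.
by case: s => //=; rewrite normc_def/= expr0n/= addr0 sqrtr_sqr.
Qed.

Lemma rnormD (R : realType) (s : scalar_kind) (a b : scalars R s) :
  rnorm (a + b) <= rnorm a + rnorm b.
Proof. by rewrite -(ler_of_real s) rmorphD/= !of_real_rnorm ler_normD. Qed.

(** If z = a + i b, the hypothesis gives a >= 0 and a^2 + b^2 <= a^2, so b = 0. This recovers the
    full value of a functional from its real part at a point where it is extremal. *)
Lemma re_part_eq_rnorm (R : realType) (s : scalar_kind) (z : scalars R s) :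
  rnorm z <= re_part z -> z = of_real s (re_part z).
Proof.
rewrite -(ler_of_real s) of_real_rnorm.
have re_eq_norm (u : R[i]) :
    `|u| <= real_complex R (complex.Re u) -> u = real_complex R (complex.Re u).
  case: u => a b; rewrite normc_def lecR /= => h.
  have a0 : 0 <= a by apply: le_trans h; exact: sqrtr_ge0.
  move: h; rewrite -[leRHS]ger0_norm// -[leRHS]sqrtr_sqr ler_sqrt ?sqr_ge0//.
  rewrite gerDl => b2; suff -> : b = 0 by [].
  by apply/eqP; rewrite -sqrf_eq0 eq_le b2 sqr_ge0.
by case: s z => //= z; exact: re_eq_norm.
Qed.

Lemma unimodular_phase (R : realType) (s : scalar_kind) (z : scalars R s) :
  exists2 w : scalars R s, rnorm w = 1 & w * z = of_real s (rnorm z).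
Proof.
have [->|z0] := eqVneq z 0.
  exists 1; last by rewrite mulr0 of_real_rnorm normr0.
  by rewrite -(rmorph1 (of_real s)) rnorm_of_real normr1.
exists (`|z| / z); last by rewrite divfK// of_real_rnorm.
apply: (can_inj (@of_realK R s)); rewrite of_real_rnorm rmorph1.
by rewrite normrM normr_id normfV divff// normr_eq0.
Qed.

(** The alias carries the real vector space structure obtained by restricting scalars along
    [of_real], so that the real Hahn-Banach theorem applies to X. *)
Definition realified (R : realType) (s : scalar_kind)
  (X : lmodType (scalars R s)) : Type := X.

Section realified_lmodule.
Variables (R : realType) (s : scalar_kind) (X : lmodType (scalars R s)).

HB.instance Definition _ := GRing.Zmodule.on (realified X).

Definition realified_scale (r : R) (x : realified X) : realified X :=
  of_real s r *: (x : X).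

Lemma realified_scaleA a b v :
  realified_scale a (realified_scale b v) = realified_scale (a * b) v.
Proof. by rewrite /realified_scale scalerA rmorphM. Qed.

Lemma realified_scale1 : left_id 1 realified_scale.
Proof. by move=> v; rewrite /realified_scale rmorph1 scale1r. Qed.

Lemma realified_scaleDr : right_distributive realified_scale +%R.
Proof. by move=> a u v; rewrite /realified_scale; exact: scalerDr. Qed.

Lemma realified_scaleDl v :
  {morph realified_scale^~ v : a b / a + b}.
Proof. by move=> a b; rewrite /realified_scale rmorphD; exact: scalerDl. Qed.

HB.instance Definition _ := GRing.Zmodule_isLmodule.Build R (realified X)
  realified_scaleA realified_scale1 realified_scaleDr realified_scaleDl.

End realified_lmodule.

Lemma realified_scaleE (R : realType) (s : scalar_kind)
  (X : lmodType (scalars R s)) (r : R) (x : realified X) :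
  r *: x = of_real s r *: (x : X).
Proof. by []. Qed.

(** In the complex case g x = f x - i f (i x); in the real case g is f itself. *)
Lemma linear_extension_re (R : realType) (s : scalar_kind)
    (X : lmodType (scalars R s)) (f : {linear realified X -> R^o}) :
  exists g : {linear X -> (scalars R s)^o}, forall z, re_part (g z) = f z.
Proof.
case: s X f => X f.
  have glin : linear (f : X -> R^o) by move=> a u v; exact: (linearP f).
  pose L := GRing.isLinear.Build R X R^o *:%R (f : X -> R^o) glin.
  pose g : {linear X -> R^o} := HB.pack (f : X -> R^o) L.
  by exists g.
pose g (x : X) : R[i]^o := Complex (f x) (- f ('i%C *: x : X)).
have fZ (r : R) (x : X) : f (real_complex R r *: x : X) = r * f x.
  exact: (linearZ_LR f r x).
have fD (x y : X) : f (x + y : X) = f x + f y by exact: (linearD f).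
have fI (x : X) : f ('i%C *: ('i%C *: x) : X) = - f x.
  rewrite scalerA; have -> : 'i%C * 'i%C = real_complex R (- 1).
    by rewrite -expr2 sqr_i rmorphN1.
  by rewrite fZ mulN1r.
have iZ (r : R) (x : X) :
    'i%C *: (real_complex R r *: x) = real_complex R r *: ('i%C *: x).
  by rewrite !scalerA mulrC.
have glin : linear g.
  move=> a u v.
  have -> : a *: u + v =
      real_complex R (complex.Re a) *: u +
        real_complex R (complex.Im a) *: ('i%C *: u) + v.
    by rewrite scalerA -scalerDl {1}[a]complexE [_ * 'i%C]mulrC.
  rewrite /g !scalerDr !iZ !fD !fZ !fI.
  case: a => a b /=; apply/eqP; rewrite eq_complex /=.
  by apply/andP; split; apply/eqP; ring.
pose L := GRing.isLinear.Build R[i] X R[i]^o *:%R g glin.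
pose G : {linear X -> R[i]^o} := HB.pack g L.
by exists G.
Qed.

(** * Suprema with default value 0 *)

(** On a set without a supremum [sup] takes the value 0, so a nonzero value certifies that the set
    is bounded above. *)
Lemma le_sup_neq0 (R : realType) (E : set R) x :
  sup E != 0 -> E x -> x <= sup E.
Proof.
move=> E0 Ex; apply: ub_le_sup => //; apply: contrapT => Eub.
by move/eqP: E0; apply; apply: sup_out => -[].
Qed.

(** The sign of [B] covers the empty set, whose [sup] is 0. *)
Lemma sup_le_ge0 (R : realType) (E : set R) B :
  0 <= B -> ubound E B -> sup E <= B.
Proof.
move=> B0 EB; have [->|/set0P E0] := eqVneq E set0; first by rewrite sup0.
exact: ge_sup.
Qed.

Lemma sup_ge0 (R : realType) (E : set R) :
  (forall x, E x -> 0 <= x) -> 0 <= sup E.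
Proof.
move=> E0; have [[[x Ex] Eub]|] := pselect (has_sup E); last by move/sup_out->.
exact: le_trans (E0 _ Ex) (ub_le_sup Eub Ex).
Qed.

(** * Support functionals, Lipschitz norm and numerical radius of one norm *)

Section eqnorm_theory.
Variables (R : realType) (s : scalar_kind) (X : normedModType (scalars R s)).
Implicit Types (p q : eqnorm X) (x y : X) (T : X -> X).
Implicit Types f : {linear X -> (scalars R s)^o}.

Lemma eqnormD p x y : p (x + y) <= p x + p y.
Proof. by have [_ + _] := eqnorm_is_norm p; exact. Qed.

Lemma eqnormZ p a x : p (a *: x) = rnorm a * p x.
Proof. by have [_ _] := eqnorm_is_norm p; exact. Qed.

Lemma eqnorm_gt0 p x : (0 < p x) = (x != 0).
Proof.
rewrite lt_neqAle eqnorm_ge0 andbT eq_sym; congr (~~ _).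
apply/eqP/eqP => [|->]; last exact: eqnorm0.
by have [+ _ _] := eqnorm_is_norm p; exact.
Qed.

Lemma rnorm_linear_le f c p :
  (forall z, rnorm (f z) <= c * p z) -> continuous f.
Proof.
move=> fc; apply: bounded_linear_continuous.
have [d [D [d0 D0 pD]]] := eqnorm_equiv p.
have c1 : 0 <= `|c| * D by rewrite mulr_ge0// ltW.
apply/linear_boundedP; near=> r => x.
apply: (@le_trans _ _ (of_real s (`|c| * D) * `|x|)); last first.
  rewrite ler_wpM2r//; near: r; apply: nbhs_pinfty_ge.
  by rewrite ger0_real// -(rmorph0 (of_real s)) ler_of_real.
rewrite -[`|f x|]of_real_rnorm -[`|x|]of_real_rnorm -rmorphM ler_of_real.
apply: (le_trans (fc x)); apply: (@le_trans _ _ (`|c| * p x)).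
  by rewrite ler_wpM2r ?eqnorm_ge0// ler_norm.
by rewrite -mulrA ler_wpM2l//; have [] := pD x.
Unshelve. all: by end_near. Qed.

(** Hahn-Banach is applied to z |-> p x * p z rather than to p, so that f already has the
    normalisation required by [lip_Pi]. *)
Lemma support_functional p x : exists f,
  (forall z, rnorm (f z) <= p x * p z) /\ f x = of_real s (p x ^+ 2).
Proof.
have PS : sublinear ((fun z : X => p x * p z) : realified X -> R).
  split=> [y z|t z t0].
    by rewrite -mulrDr ler_wpM2l ?eqnorm_ge0// eqnormD.
  by rewrite realified_scaleE eqnormZ rnorm_of_real ger0_norm// mulrCA.
have [h [hp hx]] := hahn_banach_support (x : realified X) PS.
have [g gh] := linear_extension_re h; exists g.
(* Rotating z by a phase turns |g z| into the real part of g at a vector of the same norm. *)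
have gp z : rnorm (g z) <= p x * p z.
  have [w w1 wz] := unimodular_phase (g z).
  rewrite -[leLHS](of_realK s) -wz.
  have -> : w * g z = g (w *: z) by rewrite linearZ_LR.
  by rewrite gh; apply: le_trans (hp _) _; rewrite eqnormZ w1 mul1r.
have gx : re_part (g x) = p x * p x by rewrite gh.
by split => //; rewrite [LHS]re_part_eq_rnorm gx ?expr2.
Qed.

Lemma dual_norm_support p f x : x != 0 ->
  (forall z, rnorm (f z) <= p x * p z) -> f x = of_real s (p x ^+ 2) ->
  dual_norm p f = p x.
Proof.
rewrite -(eqnorm_gt0 p) => x0 fp fx.
apply/eqP; rewrite eq_le; apply/andP; split.
  apply: sup_le_ge0; first exact: ltW.
  by move=> _ [z z1 ->]; apply: le_trans (fp z) _; rewrite ler_piMr// ltW.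
apply: ub_le_sup.
  exists (p x) => _ [z z1 ->]; apply: le_trans (fp z) _.
  by rewrite ler_piMr// ltW.
exists (of_real s (p x)^-1 *: x).
  rewrite eqnormZ rnorm_of_real ger0_norm ?invr_ge0 ?(ltW x0)//.
  by rewrite mulVf// gt_eqF.
rewrite linearZ_LR fx [rnorm _]rnormM !rnorm_of_real.
rewrite !ger0_norm ?invr_ge0 ?sqr_ge0 ?(ltW x0)//.
by rewrite expr2 mulKf// gt_eqF.
Qed.

Lemma lip_Pi_support p x y : x != y -> exists2 f, lip_Pi p (x, y, f) &
  forall z, rnorm (f z) <= p (x - y) * p z.
Proof.
move=> xy; have [f [fp fx]] := support_functional p (x - y); exists f => //.
have dual : dual_norm p f = p (x - y).
  by apply: dual_norm_support; rewrite ?subr_eq0.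
by split; rewrite ?dual ?expr2//; exact: rnorm_linear_le fp.
Qed.

(** Cancelling p (x - y) shows that the dual norm of f is p (x - y), which is nonzero. It is
    therefore a genuine supremum and bounds f on the unit ball, hence everywhere by scaling. *)
Lemma lip_Pi_bound p x y f z : lip_Pi p (x, y, f) ->
  rnorm (f z) <= p (x - y) * p z.
Proof.
case=> _ xy _ dual.
have d0 : 0 < p (x - y) by rewrite eqnorm_gt0 subr_eq0.
have {}dual : dual_norm p f = p (x - y).
  by move/eqP: dual; rewrite expr2 (inj_eq (mulIf (lt0r_neq0 d0))) => /eqP.
have [->|z0] := eqVneq z 0.
  by rewrite linear0 eqnorm0 mulr0 -(rmorph0 (of_real s)) rnorm_of_real normr0.
have pz0 : 0 < p z by rewrite eqnorm_gt0.
rewrite -ler_pdivrMr// -dual.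
apply: le_sup_neq0; first by rewrite -/(dual_norm p f) dual gt_eqF.
have pz1 : `|(p z)^-1| = (p z)^-1 by rewrite ger0_norm// invr_ge0 ltW.
exists (of_real s (p z)^-1 *: z).
  by rewrite eqnormZ rnorm_of_real pz1 mulVf// gt_eqF.
by rewrite linearZ_LR [RHS]rnormM rnorm_of_real pz1 mulrC.
Qed.

Lemma lip_norm_le p T B : 0 <= B ->
  (forall x y, p (T x - T y) <= B * p (x - y)) -> lip_norm p T <= B.
Proof.
move=> B0 TB; apply: sup_le_ge0 => // _ [x [y [xy ->]]].
by rewrite ler_pdivrMr// eqnorm_gt0 subr_eq0.
Qed.

Lemma lip_norm_ge0 p T : 0 <= lip_norm p T.
Proof.
by apply: sup_ge0 => _ [x [y [_ ->]]]; rewrite divr_ge0 ?eqnorm_ge0.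
Qed.

(** This makes the condition [lip_norm p T = 1] usable: it excludes the default value of [sup], so T
    is nonexpansive for p. *)
Lemma lip_norm_neq0_bound p T x y : lip_norm p T != 0 ->
  p (T x - T y) <= lip_norm p T * p (x - y).
Proof.
move=> T0; have [->|xy] := eqVneq x y; first by rewrite !subrr eqnorm0 mulr0.
rewrite -ler_pdivrMr ?eqnorm_gt0 ?subr_eq0//.
by apply: le_sup_neq0 => //; exists x, y.
Qed.

Lemma lip_norm_bound p T B x y :
  (forall x y, p (T x - T y) <= B * p (x - y)) ->
  p (T x - T y) <= lip_norm p T * p (x - y).
Proof.
move=> TB; have [->|xy] := eqVneq x y; first by rewrite !subrr eqnorm0 mulr0.
rewrite -ler_pdivrMr ?eqnorm_gt0 ?subr_eq0//.
apply: ub_le_sup; last by exists x, y.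
exists B => _ [u [v [uv ->]]].
by rewrite ler_pdivrMr// eqnorm_gt0 subr_eq0.
Qed.

Lemma lip_radius_ge0 p T : 0 <= lip_radius p T.
Proof.
by apply: sup_ge0 => _ [x [y [f [_ ->]]]]; rewrite divr_ge0 ?rnorm_ge0 ?sqr_ge0.
Qed.

Lemma lip_Pi_sqr_gt0 p x y f : lip_Pi p (x, y, f) -> 0 < p (x - y) ^+ 2.
Proof. by case=> _ xy _ _; rewrite exprn_gt0// eqnorm_gt0 subr_eq0. Qed.

Lemma lip_radius_le p T B : 0 <= B ->
  (forall x y f, lip_Pi p (x, y, f) ->
    rnorm (f (T x - T y)) <= B * p (x - y) ^+ 2) ->
  lip_radius p T <= B.
Proof.
move=> B0 TB; apply: sup_le_ge0 => // _ [x [y [f [Pf ->]]]].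
by rewrite ler_pdivrMr ?(lip_Pi_sqr_gt0 Pf)// TB.
Qed.

Lemma lip_Pi_lipschitz p T B x y f :
  (forall x y, p (T x - T y) <= B * p (x - y)) -> lip_Pi p (x, y, f) ->
  rnorm (f (T x - T y)) <= B * p (x - y) ^+ 2.
Proof.
move=> TB Pf; apply: (le_trans (lip_Pi_bound _ Pf)).
by rewrite expr2 mulrCA ler_wpM2l ?eqnorm_ge0.
Qed.

Lemma lip_radius_le1 p T :
  (forall x y, p (T x - T y) <= p (x - y)) -> lip_radius p T <= 1.
Proof.
move=> T1; apply: lip_radius_le => // x y f.
by apply: lip_Pi_lipschitz => u v; rewrite mul1r.
Qed.

Lemma lip_radius_ub p T B x y f :
  (forall x y, p (T x - T y) <= B * p (x - y)) -> lip_Pi p (x, y, f) ->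
  rnorm (f (T x - T y)) <= lip_radius p T * p (x - y) ^+ 2.
Proof.
move=> TB Pf; rewrite -ler_pdivrMr ?(lip_Pi_sqr_gt0 Pf)//.
apply: ub_le_sup; last by exists x, y, f.
exists B => _ [u [v [g [Pg ->]]]].
by rewrite ler_pdivrMr ?(lip_Pi_sqr_gt0 Pg)//; exact: lip_Pi_lipschitz.
Qed.

End eqnorm_theory.

(** * Comparison of the numerical radii of one map for two close norms *)

Section lip_index_estimate.
Variables (R : realType) (s : scalar_kind) (X : normedModType (scalars R s)).
Implicit Types (p q : eqnorm X) (x y : X) (T : X -> X).
Implicit Types f : {linear X -> (scalars R s)^o}.

Lemma eqnorm_perturbation_le p T a x y :
  (forall x y, p (T x - T y) <= p (x - y)) ->
  p (x - y + a *: (T x - T y)) <=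
    p (x - y) * (1 + rnorm a * lip_radius p T + 2 * rnorm a ^+ 2).
Proof.
move=> T1; pose e := T x - T y; pose x' := x + a *: e.
have dE : x - y + a *: e = x' - y by rewrite addrAC.
have a0 : 0 <= rnorm a := rnorm_ge0 a.
have nu0 := lip_radius_ge0 p T.
have nu1 : lip_radius p T <= 1 by exact: lip_radius_le1.
rewrite -/e dE.
have d0 : 0 <= p (x - y) := eqnorm_ge0 p _.
have [->|xy'] := eqVneq x' y.
  by rewrite subrr eqnorm0 mulr_ge0// !addr_ge0// ?mulr_ge0// sqr_ge0.
have [f Pf fp] := lip_Pi_support p xy'.
have D0 : 0 < p (x' - y) by rewrite eqnorm_gt0 subr_eq0.
have fD : rnorm (f (x' - y)) = p (x' - y) ^+ 2.
  by case: Pf => _ _ -> ->; rewrite rnorm_of_real ger0_norm ?sqr_ge0.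
have ed : p e <= p (x - y) by exact: T1.
(* Apply f to x' - y = (x - y) + a e. *)
have H1 : p (x' - y) ^+ 2 <= p (x' - y) * p (x - y) + rnorm a * rnorm (f e).
  rewrite -fD -{1}dE linearD linearZ_LR; apply: le_trans (rnormD _ _) _.
  by rewrite [rnorm (a *: _)]rnormM lerD2r fp.
(* The increment T x' - T y is controlled by the radius, since f belongs to the pair (x', y); the
   remainder T x - T x' has norm at most |a| p (x - y). *)
have H2 : rnorm (f e) <=
    lip_radius p T * p (x' - y) ^+ 2 + p (x' - y) * (rnorm a * p (x - y)).
  have -> : e = (T x' - T y) + (T x - T x') by rewrite addrC addrA subrK.
  rewrite linearD; apply: le_trans (rnormD _ _) _; apply: lerD.
    by apply: (@lip_radius_ub _ _ _ _ _ 1 _ _ _ _ Pf) => u v; rewrite mul1r.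
  apply: le_trans (fp _) _; rewrite ler_pM2l//; apply: le_trans (T1 _ _) _.
  rewrite -opprB -scaleN1r eqnormZ addrC addKr eqnormZ.
  rewrite -(rmorphN1 (of_real s)) rnorm_of_real normrN1 mul1r.
  by rewrite ler_wpM2l.
have H3 : p (x' - y) <= p (x - y) * (1 + rnorm a).
  rewrite -dE; apply: le_trans (eqnormD _ _ _) _.
  by rewrite mulrDr mulr1 lerD2l eqnormZ mulrC ler_wpM2r.
(* H1 and H2 divided by p (x' - y). Inserting the crude bound H3 on the right then leaves an error
   (nu + 1) t^2 d, at most 2 t^2 d because nu <= 1. *)
have H4 : p (x' - y) <=
    p (x - y) + rnorm a * (lip_radius p T * p (x' - y) + rnorm a * p (x - y)).
  rewrite -(ler_pM2l D0) -expr2; apply: le_trans H1 _.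
  rewrite mulrDr lerD2l [leRHS]mulrCA ler_wpM2l//; apply: le_trans H2 _.
  by rewrite mulrDr [in leRHS]mulrCA -expr2.
apply: le_trans H4 _; set t := rnorm a in a0 H3 *.
set nu := lip_radius p T in nu0 nu1 *; set d := p (x - y) in d0 H3 *.
have : t * (nu * p (x' - y)) <= t * (nu * (d * (1 + t))).
  by rewrite ler_wpM2l// ler_wpM2l.
have : t ^+ 2 * nu * d <= t ^+ 2 * d.
  by rewrite ler_wpM2r// ler_piMr// sqr_ge0.
rewrite expr2; nra.
Qed.

Lemma lip_radius_close p q T t :
  (forall x y, p (T x - T y) <= p (x - y)) ->
  0 < t <= 1 ->
  forall k, comparison_set p q k -> k ^+ 2 <= 1 + t ^+ 2 ->
  lip_radius q T <= lip_radius p T + 6 * t.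
Proof.
move=> T1 /andP[t0 t1] k [k1 pq] kt.
have nu0 := lip_radius_ge0 p T.
have nu1 : lip_radius p T <= 1 by exact: lip_radius_le1.
apply: lip_radius_le => [|x y f Pf]; first by rewrite addr_ge0// mulr_ge0// ltW.
set d := x - y; set e := T x - T y.
(* The phase w makes f (d + t w e) equal to q(d)^2 + t |f e|, without cancellation. *)
have [w w1 wf] := unimodular_phase (f e).
have tw : rnorm (of_real s t * w) = t.
  by rewrite rnormM rnorm_of_real w1 mulr1 ger0_norm// ltW.
have k0 : 0 <= k by apply: le_trans k1.
have D0 : 0 < q d by case: Pf => _ xy _ _; rewrite eqnorm_gt0 subr_eq0.
have fd : f d = of_real s (q d ^+ 2) by case: Pf => _ _ -> ->.
have H1 : q d ^+ 2 + t * rnorm (f e) <= q d * q (d + (of_real s t * w) *: e).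
  apply: le_trans (lip_Pi_bound _ Pf); rewrite [f (d + _)]linearD linearZ_LR fd.
  have -> : (of_real s t * w) *: f e = of_real s (t * rnorm (f e)).
    by rewrite rmorphM/= -wf mulrA.
  by rewrite -rmorphD rnorm_of_real ler_norm.
have H2 := eqnorm_perturbation_le (of_real s t * w) x y T1.
rewrite -/d -/e tw in H2.
set B := 1 + _ + _ in H2.
have B0 : 0 <= B by rewrite !addr_ge0// ?mulr_ge0// ?sqr_ge0// ltW.
(* Passing from q to p and back costs one factor k each way. *)
have H3 : q (d + (of_real s t * w) *: e) <= k ^+ 2 * q d * B.
  apply: le_trans (pq _).2 _; rewrite expr2 -!mulrA ler_wpM2l//.
  by apply: le_trans H2 _; rewrite mulrA ler_wpM2r// (pq d).1.
have H4 : q d ^+ 2 + t * rnorm (f e) <= q d ^+ 2 * ((1 + t ^+ 2) * B).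
  apply: le_trans H1 _; rewrite expr2 -mulrA ler_pM2l//; apply: le_trans H3 _.
  by rewrite mulrAC mulrC ler_wpM2l ?(ltW D0)// ler_wpM2r.
rewrite -(ler_pM2l t0) mulrCA mulrA mulrC.
(* The product is 1 + t nu + 3 t^2 + t^3 nu + 2 t^4; as t and nu are at most 1, the last three terms
   add up to at most 6 t^2. *)
have H5 : (1 + t ^+ 2) * B <= 1 + t * (lip_radius p T + 6 * t).
  rewrite /B; set nu := lip_radius p T in nu0 nu1 *.
  have tt : t ^+ 2 * t ^+ 2 <= t ^+ 2.
    by rewrite ler_piMr ?sqr_ge0// expr_le1// ltW.
  have : t ^+ 2 * (t * nu) <= t ^+ 2.
    by rewrite ler_piMr ?sqr_ge0// mulr_ile1// ltW.
  by move: tt; rewrite expr2; nra.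
have Q0 : 0 <= q d ^+ 2 by rewrite sqr_ge0.
nra.
Qed.

End lip_index_estimate.

(** * Comparison of the indices of two close norms *)

Section lip_index_continuity.
Variables (R : realType) (s : scalar_kind) (X : normedModType (scalars R s)).
Implicit Types (p q : eqnorm X) (x y : X) (T : X -> X).
Implicit Types f : {linear X -> (scalars R s)^o}.

Lemma comparison_set_sym p q k : comparison_set p q k -> comparison_set q p k.
Proof. by move=> [k1 pq]; split => // x; have [] := pq x. Qed.

Lemma lip_radiusZ_le q T B c : 0 <= c ->
  (forall x y, q (T x - T y) <= B * q (x - y)) ->
  lip_radius q (fun x => of_real s c *: T x) <= c * lip_radius q T.
Proof.
move=> c0 TB; apply: lip_radius_le => [|x y f Pf].
  by rewrite mulr_ge0// lip_radius_ge0.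
rewrite -scalerBr linearZ_LR [leLHS]rnormM rnorm_of_real ger0_norm// -mulrA.
by rewrite ler_wpM2l// (lip_radius_ub TB Pf).
Qed.

Lemma Lip0Z (c : scalars R s) T : Lip0 T -> Lip0 (fun x => c *: T x).
Proof.
move=> [T0 [k kT]]; split; first by rewrite T0 scaler0.
exists (`|c| * k) => /= -[x y] _ /=.
rewrite -scalerBr normrZ -mulrA ler_wpM2l//.
exact: (kT (x, y)).
Qed.

(** T' is T divided by its Lipschitz norm l for q. Comparing the norms in both directions gives 1 <=
    k^2 l, so the division multiplies the radius by at most k^2. *)
Lemma lip_norm_renormalize p q k T : comparison_set p q k ->
  Lip0 T -> lip_norm p T = 1 -> exists T',
  [/\ Lip0 T', lip_norm q T' = 1 & lip_radius q T' <= k ^+ 2 * lip_radius q T].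
Proof.
move=> [k1 pq] TL T1; have k0 : 0 <= k by exact: le_trans k1.
have Tp x y : p (T x - T y) <= p (x - y).
  by rewrite -[leRHS]mul1r -T1 lip_norm_neq0_bound// T1 oner_eq0.
have Tq x y : q (T x - T y) <= k ^+ 2 * q (x - y).
  apply: le_trans (pq _).2 _; rewrite expr2 -mulrA ler_wpM2l//.
  exact: le_trans (Tp _ _) (pq _).1.
have {}Tq x y := lip_norm_bound x y Tq.
set l := lip_norm q T in Tq.
have l1 : 1 <= k ^+ 2 * l.
  rewrite -T1; apply: lip_norm_le => [|x y].
    by rewrite mulr_ge0 ?sqr_ge0 ?lip_norm_ge0.
  apply: le_trans (pq _).1 _; rewrite expr2 -!mulrA ler_wpM2l//.
  apply: le_trans (Tq _ _) _; rewrite mulrCA ler_wpM2l ?lip_norm_ge0//.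
  exact: (pq _).2.
have l0 : 0 < l.
  rewrite lt_neqAle lip_norm_ge0 andbT eq_sym; apply: contraTneq l1 => ->.
  by rewrite mulr0 -ltNge.
exists (fun x => of_real s l^-1 *: T x).
have qT' x y :
    q (of_real s l^-1 *: T x - of_real s l^-1 *: T y) = l^-1 * q (T x - T y).
  by rewrite -scalerBr eqnormZ rnorm_of_real ger0_norm// invr_ge0 ltW.
have T'q x y :
    q (of_real s l^-1 *: T x - of_real s l^-1 *: T y) <= 1 * q (x - y).
  by rewrite qT' mul1r mulrC ler_pdivrMr// mulrC.
split; first exact: Lip0Z.
  apply/eqP; rewrite eq_le lip_norm_le//=.
  set m := lip_norm q _; rewrite -(ler_pM2l l0) mulr1.
  apply: lip_norm_le => [|x y].
    by rewrite mulr_ge0 ?(ltW l0)// lip_norm_ge0.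
  rewrite -mulrA -ler_pdivrMl// -qT'.
  exact: (lip_norm_bound x y T'q).
apply: le_trans (lip_radiusZ_le _ Tq) _; first by rewrite invr_ge0 ltW.
by rewrite ler_wpM2r ?lip_radius_ge0// -[leLHS]mul1r ler_pdivrMr.
Qed.

(** An almost optimal T for p, renormalised for q, has radius at most (1 + t^2) (nu + 6 t) = nu + 6
    t + t^2 nu + 6 t^3, and this is at most nu + 13 t. *)
Lemma lip_index_close p q k t : comparison_set p q k ->
  0 < t <= 1 -> k ^+ 2 <= 1 + t ^+ 2 -> lip_index q <= lip_index p + 13 * t.
Proof.
move=> pq t01 kt; have /andP[t0 t1] := t01.
have [[T0 [T0L T01]]|noT] :=
  pselect (exists T, Lip0 T /\ lip_norm p T = 1); last first.
  (* If no map has Lipschitz norm 1 for p, renormalisation shows that none has for q, and both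
     indices are the infimum 0 of the empty set. *)
  have index0 r : (forall T, Lip0 T -> lip_norm r T != 1) -> lip_index r = 0.
    move=> rT; rewrite /lip_index (_ : mkset _ = set0) ?inf0//.
    by apply/seteqP; split => // a [T [/rT/eqP T1 /T1]].
  rewrite !index0 ?add0r ?mulr_ge0 ?(ltW t0)//.
    by move=> T TL; apply/eqP => T1; apply: noT; exists T.
  move=> T TL; apply/eqP => T1; apply: noT.
  have [T' [T'L T'1 _]] := lip_norm_renormalize (comparison_set_sym pq) TL T1.
  by exists T'.
rewrite -lerBlDr; apply: lb_le_inf; first by exists (lip_radius p T0), T0.
move=> _ [T [TL T1 ->]]; rewrite lerBlDr.
have Tp x y : p (T x - T y) <= p (x - y).
  by rewrite -[leRHS]mul1r -T1 lip_norm_neq0_bound// T1 oner_eq0.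
have [T' [T'L T'1 TT']] := lip_norm_renormalize pq TL T1.
apply: (@le_trans _ _ (lip_radius q T')).
  apply: ge_inf; last by exists T'.
  by exists 0 => _ [S [_ _ ->]]; exact: lip_radius_ge0.
apply: le_trans TT' _.
have := lip_radius_close Tp t01 pq kt.
have nu0 := lip_radius_ge0 p T; have nuq0 := lip_radius_ge0 q T.
have nu1 : lip_radius p T <= 1 by exact: lip_radius_le1.
move=> close.
have : k ^+ 2 * lip_radius q T <= (1 + t ^+ 2) * (lip_radius p T + 6 * t).
  by apply: ler_pM => //; rewrite sqr_ge0.
set nu := lip_radius p T in nu0 nu1 *.
have : t ^+ 2 <= t by rewrite expr2 ler_piMr// ltW.
have : t ^+ 2 * nu <= t ^+ 2 by rewrite ler_piMr// sqr_ge0.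
have : t ^+ 2 * t <= t ^+ 2 by rewrite ler_piMr// sqr_ge0.
nra.
Qed.

End lip_index_continuity.

(** * Continuity of the index, and paths of norms *)

Section eqnorm_paths.
Variables (R : realType) (s : scalar_kind) (X : normedModType (scalars R s)).
Implicit Types p q : eqnorm X.

Lemma eqnorm_ballE p e : ball p e = [set q : eqnorm X | eqnorm_dist p q < e].
Proof. exact: (ballEmdist p e). Qed.

Lemma eqnorm_dist_le p q k : comparison_set p q k -> eqnorm_dist p q <= ln k.
Proof.
move=> pqk; have [m1 _] := comparison_set_min p q.
have m0 : 0 < inf (comparison_set p q) by exact: lt_le_trans m1.
have km := inf_comparison_set_le pqk.
by rewrite ler_ln ?posrE// (lt_le_trans m0).
Qed.

Lemma continuous_lip_index : continuous (fun p : eqnorm X => lip_index p).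
Proof.
move=> p; apply/(@cvgrPdist_le _ _ _ (nbhs p)) => /= e e0.
pose t := Num.min 1 (e / 13).
have t0 : 0 < t by rewrite lt_min ltr01 divr_gt0.
have t1 : t <= 1 by rewrite ge_min lexx.
have te : 13 * t <= e by rewrite mulrC -ler_pdivlMr// ge_min lexx orbT.
(* With k the optimal constant, ln k below this radius means k^2 < 1 + t^2. *)
have d0 : 0 < ln (1 + t ^+ 2) / 2.
  by rewrite divr_gt0// ln_gt0// ltrDl exprn_gt0.
near=> q.
have : eqnorm_dist p q < ln (1 + t ^+ 2) / 2.
  near: q; apply/nbhs_ballP; exists (ln (1 + t ^+ 2) / 2) => //.
have pqk := comparison_set_min p q; have [k1 _] := pqk.
rewrite /eqnorm_dist; set k := inf _ in pqk k1 * => kt.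
have k0 : 0 < k by exact: lt_le_trans k1.
have {}kt : k ^+ 2 <= 1 + t ^+ 2.
  rewrite -ler_ln ?posrE ?exprn_gt0// ?addr_gt0 ?exprn_gt0//.
  by rewrite lnXn// -mulr_natr -ler_pdivlMr// ltW.
have t01 : 0 < t <= 1 by rewrite t0.
have h1 := lip_index_close pqk t01 kt.
have h2 := lip_index_close (comparison_set_sym pqk) t01 kt.
rewrite ler_norml; apply/andP; split; lra.
Unshelve. all: by end_near. Qed.

Lemma combination_gt0 (a b u v : R) : 0 <= a -> 0 <= b -> 0 < a + b ->
  0 < u -> 0 < v -> 0 < a * u + b * v.
Proof.
move=> a0 b0 ab u0 v0; have [a_gt0|a_le0] := ltP 0 a.
  by rewrite ltr_pwDl ?mulr_gt0 ?mulr_ge0// ltW.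
by rewrite ltr_wpDl ?mulr_ge0 ?(ltW u0)// mulr_gt0//; lra.
Qed.

Lemma eqnorm_combination_is_norm p q (a b : R) :
  0 <= a -> 0 <= b -> 0 < a + b ->
  is_norm (fun x => a * p x + b * q x).
Proof.
move=> a0 b0 ab; split.
- move=> x xE; apply/eqP/negPn/negP => x0; move/eqP: xE; apply/negP.
  by rewrite gt_eqF// combination_gt0// eqnorm_gt0.
- move=> x y; apply: le_trans (_ : a * (p x + p y) + b * (q x + q y) <= _).
    by rewrite lerD// ler_wpM2l// eqnormD.
  by rewrite !mulrDr addrACA.
- by move=> c x; rewrite !eqnormZ mulrDr !(mulrCA (rnorm c)).
Qed.

Lemma eqnorm_combination_equiv p q (a b : R) :
  0 <= a -> 0 <= b -> 0 < a + b ->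
  equivalent_to_norm (fun x => a * p x + b * q x).
Proof.
move=> a0 b0 ab.
have [c [C [c0 C0 pE]]] := eqnorm_equiv p.
have [d [D [d0 D0 qE]]] := eqnorm_equiv q.
exists (a * c + b * d), (a * C + b * D); split.
- exact: combination_gt0.
- exact: combination_gt0.
- move=> x; have [p1 p2] := pE x; have [q1 q2] := qE x.
  by rewrite !mulrDl -!mulrA; split; apply: lerD; rewrite ler_wpM2l.
Qed.

Lemma path_weight_ge1 (t : R) : 1 <= `|1 - t| + `|t|.
Proof. by have := ler_normD (1 - t) t; rewrite subrK normr1. Qed.

(** The absolute values keep the weights nonnegative with sum at least 1, so the path is defined on
    the whole line; on [0, 1] it is the segment from p to q. *)
Definition eqnorm_path p q (t : R) : eqnorm X :=
  let ab := lt_le_trans ltr01 (path_weight_ge1 t) in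
  EqNorm (eqnorm_combination_is_norm p q (normr_ge0 _) (normr_ge0 _) ab)
         (eqnorm_combination_equiv p q (normr_ge0 _) (normr_ge0 _) ab).

(** Since the weights add up to at least 1 and p, q are k-comparable, each of p and q is at most k
    times the path norm. The bound is uniform in t, which makes the path Lipschitz. *)
Lemma eqnorm_path_ge p q k t x : comparison_set p q k ->
  p x + q x <= 2 * k * eqnorm_path p q t x.
Proof.
move=> [k1 /(_ x)[pq qp]] /=; have w := path_weight_ge1 t.
have u0 := normr_ge0 (1 - t); have v0 := normr_ge0 t.
set u := `|1 - t| in w u0 *; set v := `|t| in w v0 *.
have p0 := eqnorm_ge0 p x; have q0 := eqnorm_ge0 q x.
have k0 : 0 <= k by exact: le_trans k1.
have h1 : p x <= k * (u * p x + v * q x).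
  have a1 : u * p x <= k * (u * p x) by rewrite ler_peMl ?mulr_ge0.
  have a2 : v * p x <= k * (v * q x) by rewrite mulrCA ler_wpM2l.
  have a3 : 1 * p x <= (u + v) * p x by rewrite ler_wpM2r.
  by rewrite mulrDr; move: a3; rewrite mul1r mulrDl; lra.
have h2 : q x <= k * (u * p x + v * q x).
  have a1 : v * q x <= k * (v * q x) by rewrite ler_peMl ?mulr_ge0.
  have a2 : u * q x <= k * (u * p x) by rewrite mulrCA ler_wpM2l.
  have a3 : 1 * q x <= (u + v) * q x by rewrite ler_wpM2r.
  by rewrite mulrDr; move: a3; rewrite mul1r mulrDl; lra.
by rewrite -mulrA mulr2n mulrDl mul1r lerD.
Qed.

(** Changing the parameter alters the norm by at most |t - r| (p + q), a relative change of at most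
    2 k |t - r|; conclude by ln (1 + u) <= u. *)
Lemma eqnorm_path_dist p q k t r : comparison_set p q k ->
  eqnorm_dist (eqnorm_path p q t) (eqnorm_path p q r) <= 2 * k * `|t - r|.
Proof.
move=> pqk; have k0 : 0 <= 2 * k.
  by case: pqk => k1 _; rewrite mulr_ge0// (le_trans _ k1).
have d0 := normr_ge0 (t - r).
have step u v x :
    eqnorm_path p q u x <= (1 + 2 * k * `|u - v|) * eqnorm_path p q v x.
  have h : `|u - v| * (p x + q x) <= 2 * k * `|u - v| * eqnorm_path p q v x.
    by rewrite -[leRHS]mulrA [leRHS]mulrCA ler_wpM2l// eqnorm_path_ge.
  have p0 := eqnorm_ge0 p x; have q0 := eqnorm_ge0 q x.
  have a : `|1 - u| <= `|1 - v| + `|u - v|.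
    by rewrite (distrC u) (_ : 1 - u = 1 - v + (v - u)) ?ler_normD//; lra.
  have b : `|u| <= `|v| + `|u - v|.
    by rewrite -{1}(subrK v u) addrC ler_normD.
  apply: le_trans (_ : _ <=
    eqnorm_path p q v x + (`|u - v| * p x + `|u - v| * q x)) _.
    rewrite /= addrACA -!mulrDl; apply: lerD; exact: ler_wpM2r.
  by rewrite -mulrDr [leRHS]mulrDl mul1r lerD2l.
have cmp : comparison_set (eqnorm_path p q t) (eqnorm_path p q r)
    (1 + 2 * k * `|t - r|).
  split; first by rewrite lerDl mulr_ge0.
  by move=> x; split; [exact: step|rewrite distrC; exact: step].
apply: le_trans (eqnorm_dist_le cmp) _.
by apply: le_ln1Dx; rewrite (lt_le_trans (ltrN10 _))// mulr_ge0.
Qed.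

Lemma continuous_eqnorm_path p q : continuous (eqnorm_path p q).
Proof.
have pqk := comparison_set_min p q; set k := inf _ in pqk.
have k0 : 0 < 2 * k.
  by case: pqk => k1 _; rewrite mulr_gt0// (lt_le_trans _ k1).
move=> t; apply/cvg_ballP => e e0; near=> r.
rewrite eqnorm_ballE /=; apply: le_lt_trans (eqnorm_path_dist t r pqk) _.
rewrite mulrC -ltr_pdivlMr//; near: r.
apply: cvgr_dist_lt; rewrite ?divr_gt0//; exact: cvg_id.
Unshelve. all: by end_near. Qed.

Lemma eqnorm_path0 p q : eqnorm_path p q 0 = p.
Proof.
by apply: eqnorm_eq => x /=; rewrite subr0 normr0 normr1 mul1r mul0r addr0.
Qed.

Lemma eqnorm_path1 p q : eqnorm_path p q 1 = q.
Proof.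
by apply: eqnorm_eq => x /=; rewrite subrr normr0 normr1 mul1r mul0r add0r.
Qed.

End eqnorm_paths.

Theorem proposition2p2 (R : realType) (s : scalar_kind)
    (X : completeNormedModType (scalars R s)) :
  continuous (fun p : eqnorm X => lip_index p) /\
  is_interval (range (fun p : eqnorm X => lip_index p)).
Proof.
split; first exact: continuous_lip_index.
move=> _ _ [p _ <-] [q _ <-] c pcq.
have cont : continuous (fun t : R => lip_index (eqnorm_path p q t)).
  move=> t.
  apply: (@continuous_comp _ _ _ (eqnorm_path p q) (@lip_index R s X)).
    exact: continuous_eqnorm_path.
  exact: continuous_lip_index.
have [t _ <-] : exists2 t, t \in `[0, 1] & lip_index (eqnorm_path p q t) = c.
  apply: IVT => //; first exact: continuous_subspaceT.
  (* The intermediate value theorem asks for c between the minimum and the maximum of the two end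
     values. *)
  rewrite eqnorm_path0 eqnorm_path1; have /andP[pc cq] := pcq.
  by rewrite ge_min pc le_max cq orbT.
by exists (eqnorm_path p q t).
Qed.
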